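(* Let $G$ be a bipartite cactus graph and let $c$ be a difference-1 colouring of $G$. Then $G^c$ is configurable.
   Context: A cactus graph is a connected finite graph in which any two distinct cycles share at most one vertex. A colouring of $G$ is a map $c:E(G)\to\{\text{blue},\text{red}\}$, and $G^c$ denotes $G$ with edges so coloured; $\deg^B(v)$ and $\deg^R(v)$ denote the numbers of blue and red edges incident with $v$. The colouring $c$ is a difference-1 colouring if $\deg^B(v)-\deg^R(v)=1$ for every vertex $v$. $G^c$ is configurable if there exists a linear ordering of $V(G)$ such that for every vertex $u$, if the neighbours of $u$ listed in this order are $v_1,\dots,v_k$, then the edges $uv_1,\dots,uv_k$ alternate in colour, starting and ending with blue. *)

(* Defs.v *)
(* Uses Mathematical Components only. *)
From mathcomp Require Import all_boot.

Set Implicit Arguments.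
Unset Strict Implicit.
Unset Printing Implicit Defensive.

(* A finite simple graph is a symmetric irreflexive relation [adj] on a
   [finType]; these two properties are hypotheses where they are used. *)

Section Graph.

Variables (V : finType) (adj : rel V).

Definition edges : {set {set V}} :=
  [set [set p.1; p.2] | p : V * V & adj p.1 p.2].

Definition connected : Prop := forall x y : V, connect adj x y.

Definition bipartite : Prop :=
  exists side : V -> bool, forall x y : V, adj x y -> side x != side y.

(* A cycle is presented by the cyclic sequence of its vertices; the bound on
   the size excludes the empty cycle and the closed walks [:: x; y]. *)
Definition graph_cycle (p : seq V) : Prop := ucycle adj p /\ 2 < size p.

(* As a subgraph, a cycle is determined by its edges, whereas rotations and
   reversals of [p] present the same cycle. *)
Definition cycle_edges (p : seq V) : {set {set V}} :=
  [set [set x; next p x] | x in p].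

Definition cactus : Prop :=
  connected /\
  forall p q : seq V, graph_cycle p -> graph_cycle q ->
    cycle_edges p <> cycle_edges q ->
    #|[set x in p] :&: [set x in q]| <= 1.

Definition color := bool.
Definition Blue : color := true.
Definition Red : color := false.

(* A colouring is given as a function on all sets of vertices; only its values
   on [edges] are ever used. *)
Variable c : {set V} -> color.

Definition color_deg (k : color) (v : V) : nat :=
  #|[set a in edges | (v \in a) && (c a == k)]|.

(* Truncated subtraction is harmless here: it yields 1 exactly when the integer
   difference is 1. *)
Definition difference1 : Prop :=
  forall v : V, color_deg Blue v - color_deg Red v = 1.

(* The default [Red] makes both end conditions fail on the empty sequence. *)
Definition alternating_blue_ends (s : seq color) : Prop :=
  [/\ sorted (fun a b => a != b) s, head Red s = Blue & last Red s = Blue].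

(* Reflexivity is a consequence of totality. *)
Definition linear_order (le : rel V) : Prop :=
  [/\ antisymmetric le, transitive le & total le].

Definition configurable : Prop :=
  exists2 le : rel V, linear_order le &
    forall u : V,
      alternating_blue_ends
        [seq c [set u; v] | v <- sort le (enum [set v | adj u v])].

End Graph.

(* Main.v *)
(* Fix a reference order on the vertices. In a cactus the pairs of neighbours of
   a vertex u that follow each other through u on some cycle form a matching, so
   N(u) can be arranged alternatingly with every such pair in reference order:
   blue-red pairs go to the front, red-blue pairs to the end, and in the rest
   each colour class is sorted by the reference order. The union of these local
   orders has no directed cycle: a shortest one is x0 <_u0 x1 <_u1 ... with all
   xi distinct and all ui distinct, hence (by bipartiteness) x0 u0 x1 u1 ... is
   a cycle of the graph, around which the reference order would increase. Any
   linear extension of the union is the required ordering. *)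
Require Import Defs.
From mathcomp Require Import all_boot.

Set Implicit Arguments.
Unset Strict Implicit.
Unset Printing Implicit Defensive.

(** * Preliminaries on lists and acyclic relations *)

Lemma not_uniq_map_split (T T' : eqType) (f : T -> T') (w : seq T) :
  ~~ uniq (map f w) ->
  exists w1 p w2 q w3, w = w1 ++ p :: w2 ++ q :: w3 /\ f p = f q.
Proof.
elim: w => //= p w IH; rewrite negb_and negbK.
case/orP=> [/mapP[q /splitPr[w2 w3] eq_pq] | /IH[w1 [a [w2 [q [w3 [-> eq_aq]]]]]]].
  by exists [::], p, w2, q, w3.
by exists (p :: w1), a, w2, q, w3.
Qed.

(** Along [R] the number [k] of ancestors strictly grows: the target counts itself, and it cannot be
    an ancestor of its source without closing a cycle. *)
Lemma acyclic_linear_extension (T : finType) (R : rel T) :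
  (forall x s, ~~ cycle R (x :: s)) ->
  exists2 le : rel T, linear_order le & subrel R le.
Proof.
move=> acycR; pose k x := #|[set y | connect R y x]|.
have k_lt x y : R x y -> k x < k y.
  move=> Rxy; apply/proper_card/properP; split.
    apply/subsetP=> z; rewrite !inE => /connect_trans; apply.
    exact: connect1.
  exists y; rewrite !inE ?connect0 //.
  apply/negP=> /connectP[s path_s def_x].
  have /negP[] := acycR y s.
  by rewrite /= rcons_path path_s -def_x.
(* The multiplier exceeds every rank, so [key] compares by [k] first and breaks ties by
   [enum_rank]. *)
pose key x := k x * #|T|.+1 + enum_rank x.
have rank_lt (x : T) : enum_rank x < #|T|.+1 by exact: leq_trans (ltn_ord _) (leqnSn _).
have key_inj : injective key.
  move=> x y /(congr1 (modn^~ #|T|.+1)).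
  by rewrite /key !modnMDl !modn_small // => /ord_inj/enum_rank_inj.
exists (fun x y => key x <= key y).
  split=> [x y | y x z | x y]; [| exact: leq_trans | exact: leq_total].
  by rewrite -eqn_leq => /eqP/key_inj.
move=> x y /k_lt lt_xy; rewrite /key.
apply: leq_trans (leq_addr _ _); apply: (@leq_trans ((k x).+1 * #|T|.+1)).
  by rewrite mulSn addnC leq_add2r ltnW.
by rewrite leq_mul2r lt_xy orbT.
Qed.

(** * Alternating arrangements compatible with a matching *)

Section AlternatingArrangement.

Variables (T : eqType) (col : T -> color) (r : T -> nat) (M : rel T).

(** Together these hypotheses make [M] a matching whose pairs are directed by increasing [r]. *)
Hypothesis M_r : forall x y, M x y -> r x < r y.
Hypothesis M_out : forall x y z, M x y -> M x z -> y = z.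
Hypothesis M_in : forall x y z, M x z -> M y z -> x = y.
Hypothesis M_chain : forall x y z, M x y -> M y z -> False.

(** The start value [Red] forces blue first and is restored after a blue-red prefix; as default of
    [last] it excludes the empty list. *)
Let alternating (s : seq T) :=
  path (fun a b => a != b) Red (map col s) && last Red (map col s).

Lemma seq_argmin (s : seq T) (P : pred T) : has P s ->
  exists2 x, (x \in s) && P x & forall y, y \in s -> P y -> r x <= r y.
Proof.
elim: s => //= a s IH has_P.
have [/IH[x /andP[xs Px] min_x] | no_P] := boolP (has P s); last first.
  have Pa : P a by move: has_P; rewrite (negPf no_P) orbF.
  exists a; first by rewrite mem_head.
  move=> y; rewrite inE => /predU1P[-> // | ys Py].
  by case/hasP: no_P; exists y.
have [/andP[Pa lt_ax] | not_a] := boolP (P a && (r a < r x)).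
  exists a; first by rewrite mem_head.
  move=> y; rewrite inE => /predU1P[-> // | ys Py].
  exact: leq_trans (ltnW lt_ax) (min_x y ys Py).
exists x; first by rewrite inE xs orbT.
move=> y; rewrite inE => /predU1P[-> Pa | ]; last exact: min_x.
by move: not_a; rewrite Pa /= -leqNgt.
Qed.

(** Induction removing one element of each colour. A two-coloured pair of [M] is unrelated to all
    other elements, so it can go to the end that suits its direction. Once all pairs are
    monochromatic, the [r]-least blue and red elements have no predecessor in [M] and can go
    first. *)
Lemma alternating_arrangement (l : seq T) :
  uniq l -> count col l = (count (predC col) l).+1 ->
  exists s, [/\ perm_eq s l, alternating s & pairwise (fun x y => ~~ M y x) s].
Proof.
have [n] := ubnP (size l); elim: n => // n IH in l * => lt_n Ul count_l.
have without2 a b : a \in l -> b \in l -> col a -> ~~ col b ->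
    exists l', [/\ perm_eq l [:: a, b & l'], a \notin l', b \notin l' &
      exists s, [/\ perm_eq s l', alternating s
                  & pairwise (fun x y => ~~ M y x) s]].
  move=> al bl ca cb; have nab : b != a by apply: contraNneq cb => ->.
  have bl' : b \in rem a l by rewrite mem_rem_uniq // !inE nab.
  have pl : perm_eq l [:: a, b & rem b (rem a l)].
    by rewrite (permPl (perm_to_rem al)) perm_cons perm_to_rem.
  move: (Ul); rewrite (perm_uniq pl) /= !inE => /and3P[/norP[_ nal'] nbl' Ul'].
  exists (rem b (rem a l)); split=> //; apply: IH => //.
    by move: lt_n; rewrite (perm_size pl) /= ltnS => /ltnW.
  move: count_l; rewrite !(permP pl) /= ca (negPf cb) /=.
  by rewrite !add0n !add1n => -[].
have [] := boolP (has (fun a => has (fun b => [&& col a, ~~ col b & M a b]) l) l).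
  case/hasP=> a al /hasP[b bl /and3P[ca cb Mab]].
  have [l' [pl nal nbl [s [ps alt_s pw_s]]]] := without2 a b al bl ca cb.
  exists [:: a, b & s]; split.
  - by rewrite (permPr pl) !perm_cons.
  - by move: alt_s; rewrite /alternating /= ca (negPf cb).
  - rewrite /= pw_s andbT -andbA; apply/and3P; split.
    + by apply/negP=> /M_chain; apply; apply: Mab.
    + by apply/allP=> x _; apply/negP=> /M_chain; apply; apply: Mab.
    + apply/allP=> x; rewrite (perm_mem ps) => xl'; apply/negP=> Mxb.
      by move: nal; rewrite (M_in Mab Mxb) xl'.
move=> noBR.
have [] := boolP (has (fun a => has (fun b => [&& col a, ~~ col b & M b a]) l) l).
  case/hasP=> a al /hasP[b bl /and3P[ca cb Mba]].
  have [l' [pl nal nbl [s [ps alt_s pw_s]]]] := without2 a b al bl ca cb.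
  exists (s ++ [:: b; a]); split.
  - by rewrite (permPr pl) perm_catC (perm_catCA [:: b] [:: a] s) /= !perm_cons.
  - move: alt_s; rewrite /alternating map_cat cat_path last_cat /= => /andP[-> ->].
    by rewrite ca (negPf cb).
  - rewrite pairwise_cat pw_s /= !andbT; apply/andP; split; last first.
      by apply/negP=> /M_chain; apply; apply: Mba.
    apply/allrelP=> x y xs; rewrite !inE => /pred2P[]->; apply/negP=> Myx.
      by move: nal; rewrite -(perm_mem ps) (M_out Mba Myx) xs.
    exact: M_chain Mba Myx.
move=> noRB.
(* Without red elements the count leaves a single blue one, the base of the induction. *)
have [hasR | noR] := boolP (has (predC col) l); last first.
  have sz1 : size l = 1.
    by rewrite -(count_predC col) count_l; move: noR; rewrite has_count; case: count.
  exists l; case: l sz1 count_l {Ul lt_n IH without2 noBR noRB noR} => [|a []] //= _.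
  rewrite /alternating /= !addn0 /Red; case: (col a) => //= _; split=> //.
have hasB : has col l by rewrite has_count count_l.
have [a /andP[al ca] min_a] := seq_argmin hasB.
have [b /andP[bl /= cb] min_b] := seq_argmin hasR.
have [l' [pl nal nbl [s [ps alt_s pw_s]]]] := without2 a b al bl ca cb.
have minM x y : x \in l -> y \in l -> M x y -> col x = col y.
  move=> xl yl Mxy; move: noBR noRB.
  case cx: (col x); case cy: (col y) => //.
    by move=> /hasP[]; exists x => //; apply/hasP; exists y; rewrite // cx cy.
  by move=> _ /hasP[]; exists y => //; apply/hasP; exists x; rewrite // cx cy.
have s_l x : x \in s -> x \in l.
  by rewrite (perm_mem ps) (perm_mem pl) !inE => ->; rewrite !orbT.
have no_a x : x \in l -> ~~ M x a.
  move=> xl; apply/negP=> Mxa; have := M_r Mxa.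
  by rewrite ltnNge min_a // (minM _ _ xl al Mxa).
have no_b x : x \in l -> ~~ M x b.
  move=> xl; apply/negP=> Mxb; have := M_r Mxb.
  by rewrite ltnNge min_b //= (minM _ _ xl bl Mxb).
exists [:: a, b & s]; split.
- by rewrite (permPr pl) !perm_cons.
- by move: alt_s; rewrite /alternating /= ca (negPf cb).
- rewrite /= pw_s andbT no_a //=; apply/andP; split.
    by apply/allP=> x /s_l/no_a.
  by apply/allP=> x /s_l/no_b.
Qed.

End AlternatingArrangement.

(** * Acyclicity of the union of the local orders *)

Section LocalOrders.

Variables (V : finType) (adj : rel V).
Hypothesis adj_sym : symmetric adj.
Variable side : V -> bool.
Hypothesis adj_side : forall x y, adj x y -> side x != side y.
Variables (pos : V -> V -> nat) (r : V -> nat).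
(** The cactus property enters this section only through this link between local positions and the
    reference order. *)
Hypothesis pos_r : forall p x, graph_cycle adj p -> x \in p ->
  let u := next p x in pos u x < pos u (next p u) -> r x < r (next p u).

Definition local_lt (u x y : V) : bool :=
  [&& adj u x, adj u y & pos u x < pos u y].

(* A pair is a vertex together with the centre at which it is compared with the
   first component of the next pair. *)
Definition step : rel (V * V) := fun p q => local_lt p.2 p.1 q.1.

Definition interleave (w : seq (V * V)) : seq V :=
  flatten [seq [:: p.1; p.2] | p <- w].

Lemma path_interleave p w q : path step p (rcons w q) ->
  adj p.1 p.2 && path adj p.2 (rcons (interleave w) q.1).
Proof.
elim: w p => [|a w IH] p /=; first by case/andP=> /and3P[pp -> _]; rewrite (adj_sym p.1) pp.
by case/andP=> /and3P[pp -> _] /IH; rewrite (adj_sym p.1) pp.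
Qed.

Lemma perm_interleave w :
  perm_eq (interleave w) (map fst w ++ map snd w).
Proof.
elim: w => //= p w IH; rewrite perm_cons.
by rewrite perm_sym (perm_catCA _ [:: p.2]) /= perm_cons perm_sym.
Qed.

Lemma interleave_graph_cycle w : cycle step w -> 1 < size w ->
  uniq (map fst w) -> uniq (map snd w) -> graph_cycle adj (interleave w).
Proof.
case: w => // p w cyc_w sz_w Ufst Usnd; split; last first.
  rewrite (perm_size (perm_interleave _)) size_cat !size_map.
  by case: w sz_w {cyc_w Ufst Usnd} => //= a w _; rewrite addnS.
have [ok_p cyc] := andP (path_interleave cyc_w).
rewrite /ucycle; apply/andP; split; first by rewrite /= ok_p cyc.
rewrite (perm_uniq (perm_interleave _)) cat_uniq Ufst Usnd andbT /=.
(* Successive first components share a neighbour, so all lie on one side and every centre lies on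
   the other. *)
have side_fst q : q \in p :: w -> side q.1 = side p.1.
  rewrite inE => /predU1P[-> // | qw].
  have step_side : subrel step (fun a b => side b.1 == side a.1).
    move=> a b /and3P[/adj_side sa /adj_side sb _].
    by move: sa sb; case: (side a.2); case: (side a.1); case: (side b.1).
  have tr : transitive (fun a b : V * V => side b.1 == side a.1).
    by move=> a b d /eqP eq_a /eqP ->; rewrite eq_a.
  move: cyc_w; rewrite /= rcons_path => /andP[/(sub_path step_side) path_w _].
  by have /allP/(_ q qw)/eqP := order_path_min tr path_w.
rewrite -[_ || _]/(has (mem (map fst (p :: w))) (map snd (p :: w))).
apply/hasPn=> _ /mapP[q qw ->]; apply/mapP=> -[q' q'w eq_q].
have /and3P[/adj_side] := next_cycle cyc_w qw.
by rewrite eq_q !side_fst // eqxx.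
Qed.

Lemma step_fst p q a : p.1 = q.1 -> step a p = step a q.
Proof. by rewrite /step => ->. Qed.

(** The two entries cut the cycle into two arcs, one of which can be closed up. A common first
    component lets [q] be replaced by [p]; a common centre allows a comparison in its local
    order. *)
Lemma step_cycle_shorten w1 p w2 q w3 :
    p.1 = q.1 \/ p.2 = q.2 -> cycle step (w1 ++ p :: w2 ++ q :: w3) ->
  exists p' w', cycle step (p' :: w') /\
    size (p' :: w') < size (w1 ++ p :: w2 ++ q :: w3).
Proof.
move=> eq_pq; rewrite -(rot_cycle (size w1)) rot_size_cat /= -catA /=.
set w4 := w3 ++ w1; rewrite rcons_cat /= -cat_rcons cat_path last_rcons.
case/andP=> path2 path4.
have size_l : (size w2).+1 < size (w1 ++ p :: w2 ++ q :: w3).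
  by rewrite !size_cat /= size_cat /= !addnS !ltnS addnCA leq_addr.
have size_r : (size w4).+1 < size (w1 ++ p :: w2 ++ q :: w3).
  rewrite !size_cat /= size_cat /= !addnS !ltnS addnC.
  by rewrite leq_add2l leq_addl.
case: eq_pq => [eq1 | eq2].
  exists p, w2; split=> //.
  by move: path2; rewrite /= !rcons_path (step_fst _ eq1).
have step_head a s b : path step a (rcons s b) -> step a (head b s).
  by case: s => [|d s] /= /andP[].
have path_head a d s b : path step a (rcons s b) -> step d (head b s) ->
    path step d (rcons s b).
  by case: s => [|e s] /= /andP[_ path_s] -> .
have /and3P[pp pp' lt_p] := step_head _ _ _ path2.
have /and3P[qq qq' lt_q] := step_head _ _ _ path4.
(* If [p] cannot step to the successor of [q], then [q.1] precedes [p.1] at the common centre, so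
   [q] can step to the successor of [p]. *)
have [lt_pq | le_pq] := ltnP (pos p.2 p.1) (pos p.2 (head p w4).1).
  exists p, w4; split=> //.
  by apply: path_head path4 _; rewrite /step /local_lt pp lt_pq andbT eq2.
exists q, w2; split=> //.
apply: path_head path2 _; rewrite /step /local_lt qq -eq2 pp' /=.
by apply: leq_ltn_trans lt_p; apply: leq_trans le_pq; rewrite eq2 ltnW.
Qed.

Lemma step_acyclic p w : ~~ cycle step (p :: w).
Proof.
have [n] := ubnP (size w); elim: n => // n IH in p w * => lt_w.
apply/negP=> cyc_w.
have Uw (f : V * V -> V) :
    (forall a b, f a = f b -> a.1 = b.1 \/ a.2 = b.2) -> uniq (map f (p :: w)).
  move=> f_eq; apply: contraT => /not_uniq_map_split[w1 [a [w2 [b [w3 [def_w eq_ab]]]]]].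
  rewrite def_w in cyc_w.
  have [q [w' [cyc' sz']]] := step_cycle_shorten (f_eq _ _ eq_ab) cyc_w.
  suff lt_w' : size w' < n by have /negP[] := IH q w' lt_w'.
  by move: sz'; rewrite -def_w /= ltnS => /leq_trans; apply.
have Ufst : uniq (map fst (p :: w)) by apply: Uw => a b; left.
have Usnd : uniq (map snd (p :: w)) by apply: Uw => a b; right.
case: w => [|a w] in cyc_w Ufst Usnd {lt_w Uw} *.
  by move: cyc_w; rewrite /= andbT /step /local_lt ltnn !andbF.
have r_tr : transitive (fun a b : V * V => r a.1 < r b.1).
  by move=> ? ? ?; apply: ltn_trans.
suffices /(order_path_min r_tr)/allP/(_ p): cycle (fun a b => r a.1 < r b.1) [:: p, a & w].
  by rewrite ltnn mem_rcons mem_head => /(_ isT).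
have Uw := map_uniq Ufst.
apply: cycle_from_next => // q qw.
(* Rotating [q] to the front lets [next] on the interleaved cycle be computed; the size equation
   rules out an empty [w']. *)
have [i w' def_w] := rot_to qw.
rewrite -(next_rot i) // def_w.
have : size (rot i [:: p, a & w]) = (size w).+2 by rewrite size_rot.
move: cyc_w Ufst Usnd; rewrite -(rot_cycle i) -(rot_uniq i) -map_rot.
rewrite -(rot_uniq i (map snd _)) -map_rot def_w.
case: w' {def_w} => // b w' cyc Ufst Usnd _.
have gc := interleave_graph_cycle cyc isT Ufst Usnd.
have Ui : uniq (interleave [:: q, b & w']) by case: gc => /andP[].
have nq : q.2 != q.1.
  by move: Ui; rewrite /= !inE => /andP[/norP[]]; rewrite eq_sym.
have := pos_r gc (mem_head _ _).
rewrite /= !eqxx (negPf nq); apply.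
by case/andP: cyc => /and3P[].
Qed.

(** Chooses a centre for each comparison. Since [step] ignores the centre of its target, [v] is free
    and can be chosen to close a cycle. *)
Lemma path_step x s y :
  path (fun x y => [exists u, local_lt u x y]) x (rcons s y) ->
  exists u w, path step (x, u) w /\ forall v, step (last (x, u) w) (y, v).
Proof.
elim: s x => [|z s IH] x /=.
  by rewrite andbT => /existsP[u lt_xy]; exists u, [::].
case/andP=> /existsP[u lt_xz] /IH[v [w [path_w step_w]]].
by exists u, ((z, v) :: w); split; first by rewrite /= path_w andbT.
Qed.

Lemma local_orders_linear_extension :
  exists2 le : rel V, linear_order le & forall u, subrel (local_lt u) le.
Proof.
have [x s|le lin_le sub_le] :=
    @acyclic_linear_extension V (fun x y => [exists u, local_lt u x y]).
  apply/negP=> /path_step[u [w [path_w step_w]]].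
  by have /negP[] := step_acyclic (x, u) w; rewrite /= rcons_path path_w step_w.
by exists le => // u x y lt_xy; apply: sub_le; apply/existsP; exists u.
Qed.

End LocalOrders.

(** * Pairs of neighbours consecutive on a cycle *)

Section CactusTurns.

Variables (V : finType) (adj : rel V).

(* [turn u a b]: some cycle passes through [a], [u], [b] consecutively, in one
   of the two directions (provided that [a] and [b] differ). *)
Definition turn (u a b : V) : bool :=
  [exists n : 'I_#|V|.+1, exists p : n.-tuple V,
    [&& ucycleb adj p, 2 < size p,
        [set u; a] \in cycle_edges p & [set u; b] \in cycle_edges p]].

Lemma turnP u a b :
  reflect (exists2 p, graph_cycle adj p &
             [set u; a] \in cycle_edges p /\ [set u; b] \in cycle_edges p)
          (turn u a b).
Proof.
apply: (iffP existsP) => [[n /existsP[p /and4P[cyc sz ua ub]]] | [p [cyc sz] [ua ub]]].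
  by exists p.
(* A cycle repeats no vertex, so bounding its length by the order of the graph loses nothing. *)
have lt_p : size p < #|V|.+1.
  by case/andP: cyc => _ /card_uniqP <-; rewrite ltnS max_card.
exists (Ordinal lt_p); apply/existsP; exists (in_tuple p).
by apply/and4P.
Qed.

Lemma turn_sym u a b : turn u a b = turn u b a.
Proof. by apply/turnP/turnP=> -[p gc [ua ub]]; exists p. Qed.

Lemma cycle_edge_next (p : seq V) u a : [set u; a] \in cycle_edges p ->
  [/\ u \in p, a \in p & next p u = a \/ next p a = u].
Proof.
case/imsetP=> x xp eq_s; have yp : next p x \in p by rewrite mem_next.
have: u \in [set x; next p x] by rewrite -eq_s set21.
have: a \in [set x; next p x] by rewrite -eq_s set22.
have: x \in [set u; a] by rewrite eq_s set21.
have: next p x \in [set u; a] by rewrite eq_s set22.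
rewrite !inE => y_ua x_ua /pred2P[] def_a /pred2P[] def_u; subst u a.
- by split=> //; left; case/pred2P: y_ua.
- by split=> //; right.
- by split=> //; left.
- by split=> //; left; case/pred2P: x_ua => eq_x; rewrite -!eq_x.
Qed.

Hypothesis cactus_adj : cactus adj.

(** Both cycles contain [u] and [a], so in a cactus they have the same edges. On that cycle [u] has
    only two neighbours, and [a] is one of them. *)
Lemma turn_unique u a b b' : u != a -> a != b -> a != b' ->
  turn u a b -> turn u a b' -> b = b'.
Proof.
move=> ua ab ab' /turnP[p gcp [pa pb]] /turnP[q gcq [qa qb']].
have eq_pq : cycle_edges p = cycle_edges q.
  apply/eqP; apply: contraT => /eqP neq_pq.
  have [up ap _] := cycle_edge_next pa; have [uq aq _] := cycle_edge_next qa.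
  have := cactus_adj.2 _ _ gcp gcq neq_pq; rewrite leqNgt => /negP[].
  rewrite -[2](_ : #|[set u; a]| = 2); last by rewrite cards2 ua.
  by apply/subset_leq_card/subsetP=> x; rewrite !inE => /pred2P[]->; apply/andP.
have Up : uniq p by case: gcp => /andP[].
rewrite -eq_pq in qb'.
have prevE x y : next p x = y -> x = prev p y by move=> <-; rewrite prev_next.
have [_ _ na] := cycle_edge_next pa.
have [_ _ nb] := cycle_edge_next pb.
have [_ _ nb'] := cycle_edge_next qb'.
case: na nb nb' => na [nb|nb] [nb'|nb'].
- by rewrite -nb.
- by rewrite -na nb eqxx in ab.
- by rewrite -na nb' eqxx in ab'.
- by rewrite (prevE _ _ nb) (prevE _ _ nb').
- by rewrite -nb.
- by rewrite (prevE _ _ na) (prevE _ _ nb') eqxx in ab'.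
- by rewrite (prevE _ _ na) (prevE _ _ nb) eqxx in ab.
- by rewrite (prevE _ _ nb) (prevE _ _ nb').
Qed.

End CactusTurns.

(** * Assembling the ordering from the neighbourhoods *)

Lemma color_deg_count (V : finType) (adj : rel V) (c : {set V} -> color)
    (k : color) (u : V) : symmetric adj -> irreflexive adj ->
  color_deg adj c k u
    = count (fun v => c [set u; v] == k) (enum [set v | adj u v]).
Proof.
move=> adj_sym adj_irr.
rewrite -size_filter; set l := filter _ _.
have <- : #|l| = size l by apply/card_uniqP; rewrite filter_uniq ?enum_uniq.
rewrite /color_deg -(card_in_imset (f := fun v => [set u; v])).
  apply: eq_card => a; rewrite inE; apply/andP/imsetP.
    case=> /imsetP[[x y] /=]; rewrite inE /= => adj_xy -> /andP[].
    rewrite !inE => /orP[]/eqP eq_u /eqP ck.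
      by exists y; rewrite ?eq_u // mem_filter eq_u ck mem_enum inE adj_xy eqxx.
    exists x; last by rewrite eq_u setUC.
    by rewrite mem_filter eq_u setUC ck mem_enum inE adj_sym adj_xy eqxx.
  case=> v; rewrite mem_filter mem_enum inE => /andP[ck adj_uv] ->.
  by rewrite set21 ck; split=> //; apply/imsetP; exists (u, v); rewrite ?inE.
move=> v w; rewrite mem_filter mem_enum inE => /andP[_ uv] _ eq_s.
have : v \in [set u; w] by rewrite -eq_s set22.
by rewrite !inE => /pred2P[eq_v | //]; rewrite eq_v adj_irr in uv.
Qed.

Theorem mainTheorem2 (V : finType) (adj : rel V)
    (adj_sym : symmetric adj) (adj_irr : irreflexive adj)
    (c : {set V} -> color) :
  bipartite adj -> cactus adj -> difference1 adj c -> configurable adj c.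
Proof.
move=> [side adj_side] cac diff1.
pose r (v : V) : nat := enum_rank v.
have r_inj : injective r by move=> x y /ord_inj/enum_rank_inj.
pose M u a b := [&& u != a, u != b, r a < r b & turn adj u a b].
pose N u := enum [set v | adj u v].
have M_out u x y z : M u x y -> M u x z -> y = z.
  move=> /and4P[ux _ rxy txy] /and4P[_ _ rxz txz].
  by apply: (turn_unique cac ux _ _ txy txz); apply/eqP=> eq_x;
    [move: rxy | move: rxz]; rewrite eq_x ltnn.
have M_in u x y z : M u x z -> M u y z -> x = y.
  move=> /and4P[_ uz rxz txz] /and4P[_ _ ryz tyz].
  rewrite turn_sym in txz; rewrite turn_sym in tyz.
  by apply: (turn_unique cac uz _ _ txz tyz); apply/eqP=> eq_x;
    [move: rxz | move: ryz]; rewrite eq_x ltnn.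
have M_chain u x y z : M u x y -> M u y z -> False.
  move=> /and4P[_ uy rxy txy] /and4P[_ _ ryz tyz].
  rewrite turn_sym in txy; have := ltn_trans rxy ryz.
  rewrite (turn_unique cac uy _ _ txy tyz) ?ltnn //; apply/eqP=> eq_y;
    [move: rxy | move: ryz]; rewrite eq_y ltnn //.
have /fin_all_exists[s s_ok] u : exists s,
    [/\ perm_eq s (N u),
        path (fun a b => a != b) Red [seq c [set u; v] | v <- s]
          && last Red [seq c [set u; v] | v <- s]
      & pairwise (fun x y => ~~ M u y x) s].
  apply: (alternating_arrangement (r := r)) => //.
  - by move=> x y /and4P[].
  - exact: M_out.
  - exact: M_in.
  - exact: M_chain.
  - exact: enum_uniq.
  have := diff1 u; rewrite !color_deg_count // -/(N u).
  have -> : count (fun v => c [set u; v] == Blue) (N u)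
          = count (fun v => c [set u; v]) (N u).
    by apply: eq_count => v; rewrite eqb_id.
  have -> : count (fun v => c [set u; v] == Red) (N u)
          = count (predC (fun v => c [set u; v])) (N u).
    by apply: eq_count => v /=; rewrite eqbF_neg.
  (* The truncated difference is positive, so red does not outnumber blue and the subtraction is
     exact. *)
  move=> diff; rewrite -[LHS](@subnK (count (predC (fun v => c [set u; v])) (N u))).
    by rewrite diff add1n.
  by rewrite ltnW // -subn_gt0 diff.
have mem_s u x : (x \in s u) = adj u x.
  by case: (s_ok u) => /perm_mem -> _ _; rewrite mem_enum inE.
have uniq_s u : uniq (s u).
  by case: (s_ok u) => /perm_uniq -> _ _; rewrite enum_uniq.
pose pos u x := index x (s u).
have pos_r p x : graph_cycle adj p -> x \in p ->
    let u := next p x in pos u x < pos u (next p u) -> r x < r (next p u).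
  move=> gc xp u lt_pos; rewrite ltnNge leq_eqVlt negb_or; apply/andP; split.
    by apply: contraTneq lt_pos => /r_inj ->; rewrite ltnn.
  have [/andP[cyc _] _] := gc.
  have up : u \in p by rewrite mem_next.
  have adj_ux : adj u x by rewrite adj_sym (next_cycle cyc).
  have adj_uy := next_cycle cyc up.
  have neq v : adj u v -> u != v by move=> uv; apply: contraTneq uv => <-; rewrite adj_irr.
  have [_ _ /(pairwiseP x) pw_s] := s_ok u.
  (* Otherwise [next p u] and [x] form a pair of [M u] that [s u] lists in the wrong order. *)
  apply/negP=> lt_r; have := pw_s _ _ _ _ lt_pos.
  rewrite !inE !index_mem !mem_s => /(_ adj_ux adj_uy).
  rewrite !nth_index ?mem_s // => /negP[]; rewrite /M !neq // lt_r /=.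
  apply/turnP; exists p => //; split; apply/imsetP.
    by exists u.
  by exists x => //; rewrite setUC.
have [le [le_anti le_tr le_total] sub_le] :=
  local_orders_linear_extension adj_sym adj_side pos_r.
exists le => // u.
(* The list [s u] is itself sorted for [le], and a sorted arrangement is unique by antisymmetry. *)
have -> : sort le (enum [set v | adj u v]) = s u.
  apply: (sorted_eq le_tr le_anti); first exact: sort_sorted.
    apply/pairwise_sorted/(pairwiseP u) => i j lt_i lt_j lt_ij.
    apply: (sub_le u); rewrite /local_lt -!mem_s !mem_nth //=.
    by rewrite /pos !index_uniq.
  by rewrite perm_sort perm_sym; case: (s_ok u).
have [_ /andP[path_s last_s] _] := s_ok u.
split=> //; first exact: path_sorted path_s.
(* The value [Red] before the list makes its head blue; the empty list would have last colour
   [Red]. *)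
by case: (s u) path_s last_s => //= v s' /andP[]; case: (c _).
Qed.
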